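(* There exists a topological dynamical system $(X,f)$ which is distal and distributionally chaotic of type 3. Thus DC3 chaos does not imply Li-Yorke chaos: there is a system that is distributionally chaotic of type 3 but is not Li-Yorke chaotic.
   Context: A topological dynamical system $(X,f)$ consists of a non-empty compact metric space $(X,d)$ and a continuous map $f:X\to X$. A pair $(x_1,x_2)\in X^2$ is proximal if $\liminf_{k\to\infty} d(f^k(x_1),f^k(x_2))=0$, and distal otherwise. The system is distal if every pair of distinct points of $X$ is distal. The pair is asymptotic if $\limsup_{k\to\infty} d(f^k(x_1),f^k(x_2))=0$. A pair of distinct points is (Li-Yorke) scrambled if it is proximal but not asymptotic. A set $S\subset X$ is scrambled if every pair of distinct points of $S$ is scrambled. The system is (Li-Yorke) chaotic if it has an uncountable scrambled set. For $(x_1,x_2)\in X^2$ and $\delta>0$ put $$\Phi_{(x_1,x_2)}(\delta)=\liminf_{m\to\infty}\frac1m\#\{0\le k\le m: d(f^k(x_1),f^k(x_2))<\delta\},$$ $$\Phi^*_{(x_1,x_2)}(\delta)=\limsup_{m\to\infty}\frac1m\#\{0\le k\le m: d(f^k(x_1),f^k(x_2))<\delta\}.$$ The pair is distributionally scrambled of type 3 (a DC3 pair) if there are $0\le a<b\le \operatorname{diam}X$ such that $\Phi_{(x_1,x_2)}(\delta)<\Phi^*_{(x_1,x_2)}(\delta)$ for every $\delta\in(a,b)$. The system is distributionally chaotic of type 3 (DC3) if there is an uncountable set $S\subset X$ such that every pair of distinct points of $S$ is distributionally scrambled of type 3. *)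

(* Defs.v *)
From mathcomp Require Import all_boot all_order all_algebra.
From mathcomp Require Import all_classical all_reals all_analysis.

Set Implicit Arguments.
Unset Strict Implicit.
Unset Printing Implicit Defensive.

Import Order.TTheory GRing.Theory Num.Theory.

Local Open Scope classical_set_scope.
Local Open Scope ring_scope.

(* Inferior and superior limits, as well as the diameter, are taken in \bar R,
   where they exist without any boundedness side condition. *)

Definition dynamical_system (R : realType) (X : metricType R) (f : X -> X) :
    Prop :=
  [/\ [set: X] !=set0, compact [set: X] & continuous f].

Definition orbit_dist (R : realType) (X : metricType R) (f : X -> X)
    (x1 x2 : X) (k : nat) : R :=
  mdist (iter k f x1) (iter k f x2).

Definition proximal (R : realType) (X : metricType R) (f : X -> X)
    (x1 x2 : X) : Prop :=
  limn_einf (fun k => (orbit_dist f x1 x2 k)%:E) = 0%E.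

Definition distal_pair (R : realType) (X : metricType R) (f : X -> X)
    (x1 x2 : X) : Prop :=
  ~ proximal f x1 x2.

Definition distal (R : realType) (X : metricType R) (f : X -> X) : Prop :=
  forall x1 x2 : X, x1 <> x2 -> distal_pair f x1 x2.

Definition asymptotic (R : realType) (X : metricType R) (f : X -> X)
    (x1 x2 : X) : Prop :=
  limn_esup (fun k => (orbit_dist f x1 x2 k)%:E) = 0%E.

Definition li_yorke_pair (R : realType) (X : metricType R) (f : X -> X)
    (x1 x2 : X) : Prop :=
  [/\ x1 <> x2, proximal f x1 x2 & ~ asymptotic f x1 x2].

Definition scrambled_set (R : realType) (X : metricType R) (f : X -> X)
    (S : set X) : Prop :=
  forall x1 x2 : X, S x1 -> S x2 -> x1 <> x2 -> li_yorke_pair f x1 x2.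

Definition li_yorke_chaotic (R : realType) (X : metricType R) (f : X -> X) :
    Prop :=
  exists S : set X, ~ countable S /\ scrambled_set f S.

(* The m + 1 indices 0 <= k <= m are counted, but the normalisation is 1 / m;
   the term at m = 0 is 0 by the convention 0^-1 = 0 and is irrelevant to the
   limits below. *)
Definition visit_frequency (R : realType) (X : metricType R) (f : X -> X)
    (x1 x2 : X) (delta : R) (m : nat) : R :=
  m%:R^-1 * #|[pred k : 'I_m.+1 | orbit_dist f x1 x2 k < delta]|%:R.

Definition lower_distribution (R : realType) (X : metricType R) (f : X -> X)
    (x1 x2 : X) (delta : R) : \bar R :=
  limn_einf (fun m => (visit_frequency f x1 x2 delta m)%:E).

Definition upper_distribution (R : realType) (X : metricType R) (f : X -> X)
    (x1 x2 : X) (delta : R) : \bar R :=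
  limn_esup (fun m => (visit_frequency f x1 x2 delta m)%:E).

Definition diam (R : realType) (X : metricType R) : \bar R :=
  ereal_sup [set (mdist p.1 p.2)%:E | p in [set: X * X]].

Definition dc3_pair (R : realType) (X : metricType R) (f : X -> X)
    (x1 x2 : X) : Prop :=
  exists a b : R,
    [/\ 0 <= a, a < b, (b%:E <= diam X)%E &
      forall delta : R, a < delta < b ->
        (lower_distribution f x1 x2 delta < upper_distribution f x1 x2 delta)%E].

Definition dc3 (R : realType) (X : metricType R) (f : X -> X) : Prop :=
  exists S : set X, ~ countable S /\
    forall x1 x2 : X, S x1 -> S x2 -> x1 <> x2 -> dc3_pair f x1 x2.

(* Main.v *)
(* Let sigma be the map that adds 1 in every coordinate of prod_j Z/N_j, and let
   wave_j be a slowly varying function of the j-th coordinate, equal to 1/2 on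
   most of [M_j, 2 M_j] and to 0 off that interval, where 2 M_j is much smaller
   than N_j.  Given switches a_j in {0, 1}, fixed by the dynamics, the map
     (a, x, theta) |->
       (a, sigma x, theta + sum_j a_j (wave_j(sigma x) - wave_j(x)))
   is continuous on a compact space with circle fibres, and it is distal because
   it is an isometric extension of an isometry.  The cocycle is formally a
   coboundary, but its transfer function sum_j a_j wave_j diverges.
   Start at x = 0, theta = 0 with two switch sequences a, b.  Up to time M_j the
   two angles mostly coincide, since the lower waves vanish off a set of small
   density; if a_j <> b_j they are mostly antipodal during [M_j, 2 M_j].  Hence
   the frequency of closeness oscillates as soon as a_j <> b_j for infinitely
   many j. *)

Require Import Defs.
From HB Require Import structures.
From mathcomp Require Import all_boot all_order all_algebra.
From mathcomp Require Import all_classical all_reals all_analysis.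
From mathcomp Require Import zify ring lra.

Set Implicit Arguments.
Unset Strict Implicit.
Unset Printing Implicit Defensive.

Import Order.TTheory GRing.Theory Num.Theory.
Import numFieldNormedType.Exports.

Local Open Scope classical_set_scope.

(** * Scales, tents and the density of bad times *)

(* M_j above; the period N_j is [scale j.+1]. *)
Fixpoint scale (j : nat) : nat :=
  if j is i.+1 then 2 ^ (i + 4) * scale i else 8.

Arguments scale : simpl never.

Lemma scaleS j : scale j.+1 = 2 ^ (j + 4) * scale j.
Proof. by []. Qed.

Lemma scale_ge j : 8 * 2 ^ j <= scale j.
Proof.
elim: j => // j IH; rewrite scaleS expnS expnD.
have : 0 < 2 ^ j by rewrite expn_gt0.
nia.
Qed.

Lemma scale_gt0 j : 0 < scale j.
Proof. by apply: leq_trans (scale_ge j); rewrite muln_gt0 expn_gt0. Qed.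

Lemma scaleS_ge j : 2 * scale j <= scale j.+1.
Proof.
rewrite scaleS leq_mul2r; apply/orP; right.
by rewrite expnD -[2]/(1 * 2) leq_mul // expn_gt0.
Qed.

Lemma dvdn_scale i j : i <= j -> scale i %| scale j.
Proof.
move/subnKC <-; elim: (j - i) => [|k IH]; first by rewrite addn0.
by rewrite addnS scaleS dvdn_mull.
Qed.

Lemma leq_scale i j : i <= j -> scale i <= scale j.
Proof. by move=> ij; rewrite dvdn_leq ?scale_gt0 ?dvdn_scale. Qed.

Lemma ltn_scale j : j < scale j.
Proof. by have := ltn_expl j (ltnSn 1); have := scale_ge j; lia. Qed.

(* Truncated subtraction makes this vanish off [[scale j, 2 * scale j]]. *)
Definition tent (j n : nat) : nat :=
  minn (2 ^ j) (minn (n - scale j) (2 * scale j - n)).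

Definition active (j k : nat) : bool := scale j < k %% scale j.+1 < 2 * scale j.

Lemma tent_inactive j k : ~~ active j k -> tent j (k %% scale j.+1) = 0.
Proof. rewrite /active /tent; lia. Qed.

Lemma tent_small j n : n <= scale j -> tent j n = 0.
Proof. rewrite /tent; lia. Qed.

Lemma tent_plateau j n :
  scale j + 2 ^ j <= n <= 2 * scale j - 2 ^ j -> tent j n = 2 ^ j.
Proof. rewrite /tent; lia. Qed.

(** The tent has slope at most one, and its support ends within the period, so the wrap to 0 creates
    no jump. *)
Lemma tent_modS j n (lt_n : n < scale j.+1) :
  (tent j n <= (tent j (n.+1 %% scale j.+1)).+1)
  && (tent j (n.+1 %% scale j.+1) <= (tent j n).+1).
Proof.
have le_s := scaleS_ge j.
have [Hn|Hn] := ltnP n.+1 (scale j.+1).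
  by rewrite modn_small // /tent; lia.
have -> : n.+1 = scale j.+1 by lia.
by rewrite modnn /tent; lia.
Qed.

(** At other times all waves below level [j] vanish: on the orbit of a point [start a] the angle is
    then 0 up to time [scale j], and comes from level [j] alone up to time [scale j.+1]. *)
Definition bad (j k : nat) : bool := has (active ^~ k) (iota 0 j).

Lemma badS j k : bad j.+1 k = bad j k || active j k.
Proof. by rewrite /bad -addn1 iotaD has_cat /= orbF. Qed.

Lemma active_notbad i j k : i < j -> ~~ bad j k -> ~~ active i k.
Proof.
move=> ij /hasPn; apply; rewrite mem_iota; lia.
Qed.

Lemma bad_periodic j k : bad j (scale j + k) = bad j k.
Proof.
apply: eq_in_has => i; rewrite mem_iota => /andP[_ ij].
rewrite /active -modnDml.
by have /eqP -> : scale j %% scale i.+1 == 0 by apply: dvdn_scale; lia.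
Qed.

Lemma sum_periodic (F : nat -> nat) m q : (forall k, F (m + k) = F k) ->
  \sum_(0 <= k < q * m) F k = q * \sum_(0 <= k < m) F k.
Proof.
move=> Fm; elim: q => [|q IH]; first by rewrite !mul0n big_geq.
rewrite mulSn (@big_cat_nat _ _ _ m) ?leq_addr //= mulSn; congr (_ + _).
rewrite -{1}[m]add0n big_addn addKn -IH.
by apply: eq_bigr => k _; rewrite addnC Fm.
Qed.

Lemma sum_between a b c n : \sum_(c <= k < n) (a <= k < b) <= b - a.
Proof.
(* Capping [b] at [n] makes the bound inductive in [n]. *)
suff : \sum_(c <= k < n) (a <= k < b) <= minn n b - a by lia.
elim: n => [|n IH]; first by rewrite big_geq.
have [cn|nc] := leqP c n; last by rewrite big_geq.
rewrite big_nat_recr //=; lia.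
Qed.

Definition nbad j := \sum_(0 <= k < scale j) bad j k.

(* The bad density b_j = nbad j / scale j grows by at most 2^-(j+4) at step j;
   this is b_j <= (1 - 2^-j) / 8 without division. *)
Lemma nbad_bound j : 8 * 2 ^ j * nbad j + scale j <= 2 ^ j * scale j.
Proof.
elim: j => [|j IH]; first by rewrite /nbad big1 // => k _.
(* A period [scale j.+1] holds [2 ^ (j + 4)] copies of the old bad pattern, and level [j] adds a
   single window. *)
have rec : nbad j.+1 <= 2 ^ (j + 4) * nbad j + scale j.
  rewrite /nbad -sum_periodic; last by move=> k; rewrite bad_periodic.
  rewrite -scaleS.
  apply: (@leq_trans (\sum_(0 <= k < scale j.+1) bad j k +
     \sum_(0 <= k < scale j.+1) (scale j <= k < 2 * scale j))).
    rewrite -big_split /= big_nat [X in _ <= X]big_nat.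
    apply: leq_sum => k /andP[_ ks].
    rewrite badS /active modn_small //; lia.
  rewrite leq_add2l; apply: leq_trans (sum_between _ _ _ _) _; lia.
rewrite scaleS.
have e1 : 2 ^ j.+1 = 2 * 2 ^ j by rewrite expnS.
have e2 : 2 ^ (j + 4) = 16 * 2 ^ j by rewrite expnD; lia.
rewrite e2 in rec *; rewrite e1.
have : 0 < 2 ^ j by rewrite expn_gt0.
nia.
Qed.

Lemma nbad_le j : 8 * nbad j <= scale j.
Proof.
have := nbad_bound j; have : 0 < 2 ^ j by rewrite expn_gt0.
nia.
Qed.

Section Counting.
Variables (near : nat -> bool) (j : nat).

Lemma visits_ge : (forall k, k < scale j -> ~~ bad j k -> near k) ->
  7 * scale j <= 8 * \sum_(0 <= k < (scale j).+1) near k.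
Proof.
move=> nearP; rewrite big_nat_recr //=.
have : scale j <= \sum_(0 <= k < scale j) near k + nbad j.
  rewrite -big_split /= -[leqLHS](subn0) -[leqLHS](muln1) -sum_nat_const_nat.
  rewrite big_nat [leqRHS]big_nat; apply: leq_sum => k /andP[_ ks].
  by have := nearP k ks; case: (bad j k) => [_|->] //; rewrite addn1.
have := nbad_le j; lia.
Qed.

(** In units of [scale j]: the first half counts fully, and the second half contributes at most 1/8
    from bad times, 1/4 from the two ramps of length [2 ^ j], and 1/8 from the final index, as
    [8 * 2 ^ j <= scale j]. The total is 12/8. *)
Lemma visits_le :
    (forall k, scale j + 2 ^ j <= k <= 2 * scale j - 2 ^ j -> ~~ bad j k ->
       ~~ near k) ->
  8 * \sum_(0 <= k < (2 * scale j).+1) near k <= 12 * scale j.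
Proof.
move=> farP; have s8 := scale_ge j.
have p0 : 0 < 2 ^ j by rewrite expn_gt0.
rewrite big_nat_recr //= (@big_cat_nat _ _ _ (scale j)) //=; last by lia.
have h1 : \sum_(0 <= k < scale j) near k <= scale j.
  rewrite -[leqRHS](subn0) -[leqRHS](muln1) -sum_nat_const_nat.
  by apply: leq_sum => k _; exact: leq_b1.
have h2 : \sum_(scale j <= k < 2 * scale j) near k <=
    nbad j + (2 ^ j + 2 ^ j).
  have -> : nbad j = \sum_(scale j <= k < 2 * scale j) bad j k.
    rewrite -{1}[scale j]add0n big_addn mul2n -addnn addnK.
    by apply: eq_bigr => k _; rewrite addnC bad_periodic.
  apply: (@leq_trans (\sum_(scale j <= k < 2 * scale j)
      (bad j k + ((scale j <= k < scale j + 2 ^ j) +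
                  (2 * scale j - 2 ^ j <= k < 2 * scale j))))).
    rewrite big_nat [leqRHS]big_nat; apply: leq_sum => k ks.
    have := farP k; case: (bad j k); case: (near k); lia.
  rewrite 2!big_split /= leq_add2l; apply: leq_add.
    by apply: leq_trans (sum_between _ _ _ _) _; lia.
  by apply: leq_trans (sum_between _ _ _ _) _; lia.
have := nbad_le j; have := leq_b1 (near (2 * scale j)); lia.
Qed.

End Counting.

Local Open Scope ring_scope.

(** * One-sided bounds on inferior and superior limits *)

Section LimitBounds.
Context {R : realType}.
Implicit Type u : (\bar R)^nat.

Lemma limn_esup_ge_frequently u (c : \bar R) :
  (forall n, exists2 m, (n <= m)%N & (c <= u m)%E) -> (c <= limn_esup u)%E.
Proof.
move=> cu; rewrite limn_esup_lim; apply: lime_ge; first exact: is_cvg_esups.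
apply: nearW => n; have [m nm cm] := cu n.
by apply: le_trans cm _; apply: ereal_sup_ubound; exists m.
Qed.

Lemma limn_einf_le_frequently u (c : \bar R) :
  (forall n, exists2 m, (n <= m)%N & (u m <= c)%E) -> (limn_einf u <= c)%E.
Proof.
move=> uc; rewrite limn_einf_lim; apply: lime_le; first exact: is_cvg_einfs.
apply: nearW => n; have [m nm cm] := uc n.
by apply: le_trans _ cm; apply: ereal_inf_lbound; exists m.
Qed.

Lemma limn_einf_ge u (c : \bar R) :
  (forall n, (c <= u n)%E) -> (c <= limn_einf u)%E.
Proof.
move=> cu; rewrite limn_einf_lim; apply: lime_ge; first exact: is_cvg_einfs.
by apply: nearW => n; apply: le_ereal_inf_tmp => _ [m _ <-].
Qed.

End LimitBounds.

(** * The circle R/Z *)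

Section Circle.
Context {R : realType}.
Implicit Types r s : R.

(** Distance to the nearest integer; on a difference it is the arc metric of R/Z. *)
Definition dist_int r : R := `|r - (Num.floor (r + 2^-1))%:~R|.

(** Rounding leaves a remainder in [-1/2, 1/2), and every other integer is at distance at least
    1/2. *)
Lemma dist_int_le r (z : int) : dist_int r <= `|r - z%:~R|.
Proof.
rewrite /dist_int; set n := Num.floor _.
have /andP[h1 h2] : n%:~R <= r + 2^-1 < (n + 1)%:~R by rewrite floor_le_tmp floorD1_gt.
rewrite intrD in h2.
have [zn|nz|->//] := ltgtP z n.
  have : (z + 1)%:~R <= n%:~R :> R by rewrite ler_int; lia.
  rewrite intrD => zn'; apply: (@le_trans _ _ 2^-1).
    rewrite ler_norml; lra.
  rewrite ler_normr; apply/orP; left; lra.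
have : (n + 1)%:~R <= z%:~R :> R by rewrite ler_int; lia.
rewrite intrD => zn'; apply: (@le_trans _ _ 2^-1).
  rewrite ler_norml; lra.
rewrite ler_normr; apply/orP; right; lra.
Qed.

Lemma dist_intE r : exists z : int, dist_int r = `|r - z%:~R|.
Proof. by eexists. Qed.

Lemma dist_int_ge0 r : 0 <= dist_int r.
Proof. exact: normr_ge0. Qed.

Lemma dist_int_le_norm r : dist_int r <= `|r|.
Proof. by have := dist_int_le r 0; rewrite subr0. Qed.

Lemma dist_intN r : dist_int (- r) = dist_int r.
Proof.
suff le s : dist_int (- s) <= dist_int s.
  by apply/eqP; rewrite eq_le le -{1}[r]opprK le.
have [z ->] := dist_intE s; apply: le_trans (dist_int_le _ (- z)) _.
by rewrite mulrNz -opprD normrN.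
Qed.

Lemma dist_intD r s : dist_int (r + s) <= dist_int r + dist_int s.
Proof.
have [y ->] := dist_intE r; have [z ->] := dist_intE s.
apply: le_trans (dist_int_le _ (y + z)) _.
by rewrite intrD opprD addrACA ler_normD.
Qed.

Lemma dist_int_addz r (z : int) : dist_int (r + z%:~R) = dist_int r.
Proof.
suff le s (y : int) : dist_int (s + y%:~R) <= dist_int s.
  by apply/eqP; rewrite eq_le le -{1}[r](addrK z%:~R) -mulrNz le.
have [x ->] := dist_intE s; apply: le_trans (dist_int_le _ (x + y)) _.
by rewrite intrD opprD addrACA subrr addr0.
Qed.

Lemma dist_int_half : dist_int (2^-1 : R) = 2^-1.
Proof.
rewrite /dist_int (_ : 2^-1 + 2^-1 = 1%:~R :> R); last by lra.
by rewrite intrKfloor ler0_norm; lra.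
Qed.

Definition frac_part r : R := r - (Num.floor r)%:~R.

Lemma frac_part_itv r : 0 <= frac_part r < 1.
Proof.
have : (Num.floor r)%:~R <= r < (Num.floor r + 1)%:~R by rewrite floor_le_tmp floorD1_gt.
rewrite intrD /frac_part; lra.
Qed.

Lemma frac_part_id r : 0 <= r < 1 -> frac_part r = r.
Proof.
by move=> r01; rewrite /frac_part (@floor_def _ _ 0) ?subr0// add0r.
Qed.

Lemma frac_part_addz r (z : int) : frac_part (r + z%:~R) = frac_part r.
Proof.
by rewrite /frac_part floorDrz ?intr_int// intrKfloor intrD opprD addrACA subrr addr0.
Qed.

Lemma frac_partD r s : frac_part (frac_part r + s) = frac_part (r + s).
Proof. by rewrite {2}/frac_part addrAC -mulrNz frac_part_addz. Qed.

Lemma dist_int_frac_part r s : dist_int (frac_part r - frac_part s) = dist_int (r - s).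
Proof.
have -> : frac_part r - frac_part s = (r - s) + (Num.floor s - Num.floor r)%:~R.
  by rewrite /frac_part intrD mulrNz; ring.
exact: dist_int_addz.
Qed.

Lemma dist_int_eq0 r s : 0 <= r < 1 -> 0 <= s < 1 ->
  dist_int (r - s) = 0 -> r = s.
Proof.
move=> r01 s01; have [z ->] := dist_intE (r - s).
move=> /eqP; rewrite normr_eq0 subr_eq0 => /eqP rsz.
have z1 : z%:~R < 1%:~R :> R by rewrite -rsz; lra.
have z2 : (-1)%:~R < z%:~R :> R by rewrite -rsz; lra.
rewrite !ltr_int in z1 z2; have z0 : z = 0 by lia.
move: rsz; rewrite z0; lra.
Qed.

End Circle.

(** * Series dominated by a geometric series *)

Lemma half_expn_lt {R : archiRealFieldType} (e : R) :
  0 < e -> exists k, 2^-1 ^+ k < e.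
Proof.
move=> e0; exists (Num.bound e^-1).
have := @upper_nthrootP R e^-1 _ (leqnn _).
by rewrite exprVn -[X in _ < X]invrK ltf_pV2 ?posrE ?invr_gt0 ?exprn_gt0.
Qed.

Section SeriesTail.
Context {R : realType}.
Implicit Types u v : R^nat.

Definition half_bounded u := forall j, `|u j| <= 2^-1 ^+ j.+1.

Lemma half_bounded_cvg u : half_bounded u -> cvgn (series u).
Proof.
move=> ub; apply: normed_cvg; apply: (@series_le_cvg _ _ (geometric 2^-1 2^-1)).
- by move=> n; exact: normr_ge0.
- by move=> n; rewrite /geometric /= mulr_ge0 // exprn_ge0.
- by move=> n; rewrite /geometric /= -exprS.
- by apply: is_cvg_geometric_series; rewrite ger0_norm; lra.
Qed.

Lemma series_tail u v k : half_bounded u -> half_bounded v ->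
  (forall j, (j < k)%N -> u j = v j) ->
  `|limn (series u) - limn (series v)| <= 2 * 2^-1 ^+ k.
Proof.
move=> ub vb uv.
(* The right side is the sum of 2^-j over k <= j < n, since two terms of index j differ by at most 2
   * 2^-(j+1). *)
have partial n : `|series u n - series v n| <= 2 * 2^-1 ^+ k - 2 * 2^-1 ^+ (maxn n k).
  rewrite /series /=; elim: n => [|n IH].
    by rewrite !big_geq // subrr normr0 max0n subrr.
  rewrite !big_nat_recr //= opprD addrACA.
  apply: le_trans (ler_normD _ _) _.
  have [nk|kn] := ltnP n k.
    rewrite uv // subrr normr0 addr0; apply: le_trans IH _.
    by rewrite (maxn_idPr (ltnW nk)) (maxn_idPr nk).
  rewrite (maxn_idPl kn) in IH; rewrite (maxn_idPl (leqW kn)).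
  have := ler_normB (u n) (v n); have := ub n; have := vb n.
  rewrite exprS; lra.
have cu := half_bounded_cvg ub; have cv := half_bounded_cvg vb.
rewrite -limB //.
have cuv : cvgn (series u - series v) by exact: is_cvgB.
rewrite -lim_norm //; apply: limr_le; first exact: is_cvg_norm.
apply: nearW => n; apply: le_trans (partial n) _.
by rewrite gerBl mulr_ge0 // exprn_ge0.
Qed.

Lemma series_finite u k : half_bounded u ->
  (forall j, (k <= j)%N -> u j = 0) -> limn (series u) = \sum_(0 <= j < k) u j.
Proof.
move=> ub u0; apply: cvg_lim => //; apply: (@cvg_near_cst _ _ _ _ _ _).
exists k => //= n kn; rewrite /series /= (@big_cat_nat _ _ _ k) //=.
by rewrite [X in _ + X]big_nat [X in _ + X]big1 ?addr0 // => j /andP[/u0].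
Qed.

End SeriesTail.

(** * The base: switches and clocks *)

(** Pairing the switch a_j with the coordinate in Z/N_j lets one product of finite sets carry
    both. *)
Definition cell (j : nat) : Type := (bool * 'I_(scale j.+1))%type.

Definition base : Type := forall j, cell j.

Section BaseMetric.
Context {R : realType}.
Implicit Types x y z : base.

(* The factor 1/4 keeps base distances at most 1/4, below the fibre distance 1/2
   of antipodal points: thresholds in (1/4, 1/2) only see the fibre. *)
Definition base_dist x y : R :=
  if pselect (exists k, x k != y k) is left e then 2^-1 ^+ (ex_minn e).+2 else 0.

Lemma base_dist_ge x y k : x k != y k -> 2^-1 ^+ k.+2 <= base_dist x y.
Proof.
move=> xy; rewrite /base_dist; case: pselect => [e|[]]; last by exists k.
case: ex_minnP => m _ /(_ k xy) mk.
by rewrite ler_wiXn2l //; lra.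
Qed.

Lemma base_dist_le x y k : (forall i, (i < k)%N -> x i = y i) ->
  base_dist x y <= 2^-1 ^+ k.+2.
Proof.
move=> xy; rewrite /base_dist; case: pselect => [e|_]; last by rewrite exprn_ge0.
case: ex_minnP => m xym _; rewrite ler_wiXn2l //; try lra.
by rewrite !ltnS leqNgt; apply: contra xym => /xy ->.
Qed.

Lemma base_dist_le4 x y : base_dist x y <= 4^-1.
Proof.
apply: le_trans (@base_dist_le x y 0 _) _ => //.
by rewrite expr2; lra.
Qed.

Lemma base_distxx x : base_dist x x = 0.
Proof.
by rewrite /base_dist; case: pselect => // e; exfalso; case: e => k; rewrite eqxx.
Qed.

Lemma base_dist_ge0 x y : 0 <= base_dist x y.
Proof. by rewrite /base_dist; case: pselect => [e|_]; rewrite ?exprn_ge0. Qed.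

Lemma base_dist_eq0 x y : base_dist x y = 0 -> x = y.
Proof.
move=> d0; apply: functional_extensionality_dep => k; apply/eqP/negPn/negP.
by move=> /base_dist_ge; rewrite d0 leNgt exprn_gt0.
Qed.

(** Coordinatewise injections preserve the first index of disagreement; this makes the base map an
    isometry. *)
Lemma base_dist_mono (g : forall j, cell j -> cell j) x y :
  (forall j, injective (g j)) ->
  base_dist (fun j => g j (x j)) (fun j => g j (y j)) = base_dist x y.
Proof.
move=> gI; rewrite /base_dist.
case: pselect => [e|ne]; case: pselect => [e'|ne'] //.
- congr (_ ^+ _); do 2 congr S; apply: eq_ex_minn => k.
  by rewrite (inj_eq (gI k)).
- by case: ne'; case: e => k; rewrite (inj_eq (gI k)); exists k.
- by case: ne; case: e' => k; rewrite -(inj_eq (gI k)); exists k.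
Qed.

Lemma base_distC x y : base_dist x y = base_dist y x.
Proof.
rewrite /base_dist.
case: pselect => [e|ne]; case: pselect => [e'|ne'] //.
- congr (_ ^+ _); do 2 congr S; apply: eq_ex_minn => k.
  by rewrite eq_sym.
- by case: ne'; case: e => k; rewrite eq_sym; exists k.
- by case: ne; case: e' => k; rewrite eq_sym; exists k.
Qed.

(** At the first index where [x] and [z] differ, [y] differs from one of them. *)
Lemma base_dist_triangle y x z :
  base_dist x z <= base_dist x y + base_dist y z.
Proof.
have xy := base_dist_ge0 x y; have yz := base_dist_ge0 y z.
rewrite {1}/base_dist; case: pselect => [e|_]; last by rewrite addr_ge0.
case: ex_minnP => m xzm _.
have [eqm|/base_dist_ge] := eqVneq (x m) (y m); last lra.
by move: xzm; rewrite eqm => /base_dist_ge; lra.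
Qed.

End BaseMetric.

(** * The metric on base times circle *)

(* A point of the circle R/Z is stored as its representative in [0, 1). *)
Definition skew_space (R : realType) : Type := (base * {r : R | 0 <= r < 1})%type.

HB.instance Definition _ (R : realType) := gen_eqMixin (skew_space R).
HB.instance Definition _ (R : realType) := gen_choiceMixin (skew_space R).

Section SpaceMetric.
Context {R : realType}.
Implicit Types p q : skew_space R.

Definition space_dist p q : R :=
  Num.max (base_dist p.1 q.1) (dist_int (val p.2 - val q.2)).

Let space_distxx p : space_dist p p = 0.
Proof.
rewrite /space_dist base_distxx subrr; apply/max_idPl.
by have := @dist_int_le_norm R 0; rewrite normr0.
Qed.

Let space_dist_eq0 p q : space_dist p q = 0 -> p = q.
Proof.
move=> d0; have : space_dist p q <= 0 by rewrite d0.
rewrite ge_max => /andP[d1 d2].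
case: p q d1 d2 {d0} => [x r] [y s] /= d1 d2; congr pair.
  by apply/(@base_dist_eq0 R)/le_anti; rewrite d1 base_dist_ge0.
apply/val_inj/dist_int_eq0; [exact: (valP r)|exact: (valP s)|].
by apply/le_anti; rewrite d2 dist_int_ge0.
Qed.

Let space_distC p q : space_dist p q = space_dist q p.
Proof. by rewrite /space_dist base_distC -dist_intN opprB. Qed.

Let space_dist_triangle q p r :
  space_dist p r <= space_dist p q + space_dist q r.
Proof.
rewrite {1}/space_dist ge_max; apply/andP; split.
  apply: le_trans (base_dist_triangle q.1 _ _) _.
  by rewrite lerD // le_max lexx.
rewrite -[val p.2](subrK (val q.2)) -addrA.
apply: le_trans (dist_intD _ _) _.
by rewrite lerD // le_max lexx orbT.
Qed.

HB.instance Definition _ := @isMetric.Build R (skew_space R) space_dist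
  space_distxx space_dist_eq0 space_distC space_dist_triangle.

Lemma mdist_space p q : mdist p q = space_dist p q.
Proof. by []. Qed.

End SpaceMetric.

Definition circle_of {R : realType} (r : R) : {r : R | 0 <= r < 1} :=
  exist _ (frac_part r) (frac_part_itv r).

Lemma mdist_circle_of {R : realType} (x y : base) (r s : R) :
  mdist ((x, circle_of r) : skew_space R) ((y, circle_of s) : skew_space R) =
  Num.max (base_dist x y) (dist_int (r - s)).
Proof. by rewrite mdist_space /space_dist /= dist_int_frac_part. Qed.

(** * Compactness *)

Section Compactness.
Context {R : realType}.

Local Notation cells := (prod_topology (fun j => discrete_topology (cell j))).

(** A continuous parametrisation by a product space, which reduces compactness to Tychonoff's
    theorem and a closed interval. *)
Let chart (u : cells * R) : skew_space R :=
  (u.1, circle_of u.2).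

Let chart_continuous : continuous chart.
Proof.
move=> [x r] A /= /nbhs_ballP[e /= e0 eA].
have [k ke] := half_expn_lt e0.
rewrite nbhs_simpl /=.
pose U := [set y : cells | forall i, (i < k)%N -> x i = y i].
exists (U, ball r e).
  split => /=; last exact: nbhsx_ballx.
  suff : nbhs x [set y : cells | forall i : 'I_k, x i = y i].
    by apply: filterS => y xy i ik; exact: (xy (Ordinal ik)).
  apply: (@filter_forall _ _ (fun (i : 'I_k) (y : cells) => x i = y i) _
    (@nbhs_filter cells x)) => i.
  by apply: (@proj_continuous _ (fun j => discrete_topology (cell j)) i x).
move=> [y s] [/= Uy rs]; apply: eA.
rewrite ballEmdist /= mdist_circle_of gt_max; apply/andP; split.
  apply: le_lt_trans (base_dist_le Uy) (le_lt_trans _ ke).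
  by rewrite ler_wiXn2l ?leqW //; lra.
apply: le_lt_trans (dist_int_le_norm _) _.
exact: rs.
Qed.

Lemma space_compact : compact [set: skew_space R].
Proof.
(* The closed interval [0, 1] can replace [0, 1) because [circle_of] wraps 1 to 0. *)
have -> : [set: skew_space R] = chart @`
    ([set u | forall j, [set: discrete_topology (cell j)] (u j)]
     `*` `[0, 1]%classic).
  apply/seteqP; split => // -[x [r r01]] _.
  exists (x, r) => /=.
    by split => //=; rewrite in_itv /=; case/andP: r01 => -> /ltW ->.
  by rewrite /chart /=; congr pair; apply/val_inj; rewrite /= frac_part_id.
apply: (@continuous_compact (cells * R)%type (skew_space R) chart).
  exact/continuous_subspaceT/chart_continuous.
apply: compact_setX; last exact: segment_compact.
apply: (@tychonoff nat (fun j => discrete_topology (cell j))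
  (fun j => setT)) => j.
by apply: finite_compact; exact: (@finite_finset (cell j)).
Qed.

End Compactness.

(** * The skew product: continuity, distality and explicit orbits *)

Section SkewProduct.
Context {R : realType}.
Implicit Types (x y : base) (p q : skew_space R).

Definition turn j (c : cell j) : cell j := (c.1, ordS c.2).

(** The plateau [2 ^ j] becomes 1/2, half a turn, while one clock step changes the wave by at most
    2^-(j+1). So the drift series converges uniformly even where the sum of the waves diverges. *)
Definition wave j (c : cell j) : R :=
  if c.1 then 2^-1 ^+ j.+1 * (tent j c.2)%:R else 0.

Definition drift x : R^nat := fun j => wave (turn (x j)) - wave (x j).

Definition skew_map p : skew_space R :=
  (fun j => turn (p.1 j), circle_of (val p.2 + limn (series (drift p.1)))).

Lemma drift_half_bounded x : half_bounded (drift x).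
Proof.
move=> j; rewrite /drift /wave /turn /=; case: (x j) => [[] i] /=; last first.
  by rewrite subr0 normr0 exprn_ge0.
have /andP[h1 h2] := tent_modS (ltn_ord i).
rewrite -mulrBr normrM ger0_norm ?exprn_ge0 // ler_piMr ?exprn_ge0 //.
move: h1 h2; rewrite -!(ler_nat R) -!natr1 => h1 h2.
rewrite ler_norml; lra.
Qed.

Lemma turn_inj j : injective (@turn j).
Proof. by move=> [a i] [b k] [-> ?]; congr pair; apply/ordS_inj/val_inj. Qed.

Lemma skew_map_continuous : continuous skew_map.
Proof.
move=> p A /= /nbhs_ballP[e /= e0 eA].
(* Half of [e] pays for the initial fibre distance, the other half for the drift tail 2 * 2^-k. *)
have [k ke] : exists k, 2^-1 ^+ k < e / 4 by apply: half_expn_lt; lra.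
have k0 : 0 < 2^-1 ^+ k.+2 :> R by rewrite exprn_gt0.
rewrite nbhs_simpl /=; apply/nbhs_ballP.
exists (Num.min (2^-1 ^+ k.+2) (e / 2)); first by rewrite /= lt_min k0; lra.
move=> q; rewrite ballEmdist /= mdist_space /space_dist gt_max !lt_min.
move=> /andP[/andP[pqk pqe] /andP[_ pqe']]; apply: eA.
have agree i : (i < k)%N -> p.1 i = q.1 i.
  move=> ik; apply/eqP/negPn/negP => /(@base_dist_ge R).
  apply/negP; rewrite -ltNge; apply: lt_le_trans pqk _.
  by rewrite ler_wiXn2l ?ltnS ?(ltnW ik) //; lra.
rewrite ballEmdist /= mdist_circle_of gt_max base_dist_mono; last exact: turn_inj.
apply/andP; split; first lra.
rewrite opprD addrACA; apply: le_lt_trans (dist_intD _ _) _.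
have := dist_int_le_norm (limn (series (drift p.1)) - limn (series (drift q.1))).
have : `|limn (series (drift p.1)) - limn (series (drift q.1))| <= 2 * 2^-1 ^+ k.
  apply: series_tail => [||j /agree pqj]; try exact: drift_half_bounded.
  by rewrite /drift pqj.
lra.
Qed.

Lemma base_dist_iter p q k :
  base_dist (iter k skew_map p).1 (iter k skew_map q).1 = base_dist p.1 q.1 :> R.
Proof. by elim: k => //= k <-; rewrite base_dist_mono //; exact: turn_inj. Qed.

(** Points over the same base point are always rotated by the same angle. *)
Lemma mdist_iter_fibre p q k : p.1 = q.1 ->
  mdist (iter k skew_map p) (iter k skew_map q) = mdist p q.
Proof.
move=> pq; have eq1 n : (iter n skew_map p).1 = (iter n skew_map q).1.
  by elim: n => //= n ->.
elim: k => //= k <-; rewrite mdist_circle_of eq1 base_distxx.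
by rewrite mdist_space /space_dist eq1 base_distxx opprD addrACA subrr addr0.
Qed.

(** Over distinct base points the invariant base distance bounds the orbit distance below; within a
    fibre the whole distance is invariant. *)
Lemma skew_map_distal : distal skew_map.
Proof.
move=> p q pq; suff [c c0 cle] : exists2 c : R, 0 < c &
    forall k, c <= orbit_dist skew_map p q k.
  rewrite /distal_pair /proximal => lim0.
  have := @limn_einf_ge R (fun k => (orbit_dist skew_map p q k)%:E) c%:E.
  by rewrite lim0 lee_fin leNgt c0 => /(_ (fun k => cle k)).
have [pq1|pq1] := pselect (p.1 = q.1).
  exists (mdist p q); first by rewrite mdist_gt0; exact/eqP.
  by move=> k; rewrite /orbit_dist mdist_iter_fibre.
exists (base_dist p.1 q.1).
  rewrite lt_neqAle base_dist_ge0 andbT eq_sym.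
  by apply/eqP => /base_dist_eq0.
by move=> k; rewrite -(base_dist_iter p q k) /orbit_dist mdist_space le_max lexx.
Qed.

Definition clock (a : nat -> bool) n : base :=
  fun j => (a j, Ordinal (ltn_pmod n (scale_gt0 j.+1))).

Definition start a : skew_space R := (clock a 0, circle_of 0).

Definition phase a J n : R := \sum_(0 <= j < J) wave (clock a n j).

Lemma turn_clock a n j : turn (clock a n j) = clock a n.+1 j.
Proof.
congr pair; apply/val_inj => /=.
by rewrite -addn1 modnDml addn1.
Qed.

Lemma wave_clock_small a n j : (n <= scale j)%N -> wave (clock a n j) = 0.
Proof.
move=> nj; rewrite /wave /=; case: (a j) => //.
have := scaleS_ge j; have := scale_gt0 j => s0 s2.
by rewrite modn_small ?tent_small ?mulr0 //; lia.
Qed.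

Lemma wave_clock_notbad a n i j : (i < j)%N -> ~~ bad j n ->
  wave (clock a n i) = 0.
Proof.
move=> ij nb; rewrite /wave /=; case: (a i) => //.
by rewrite tent_inactive ?mulr0 // (active_notbad ij).
Qed.

(** Levels from [J] on are still zero up to time [scale J], and the drift of the lower levels
    telescopes to their transfer sum. *)
Lemma iter_start a J n : (n <= scale J)%N ->
  iter n skew_map (start a) = (clock a n, circle_of (phase a J n)).
Proof.
elim: n => [_|n IH nJ].
  congr (_, circle_of _); rewrite /phase big1 // => j _.
  by rewrite wave_clock_small.
rewrite iterS IH ?(ltnW nJ) // /skew_map /=; congr pair.
  by apply: functional_extensionality_dep => j; rewrite turn_clock.
apply/val_inj; rewrite /= frac_partD; congr frac_part.
rewrite (@series_finite _ _ J); first last.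
- move=> j Jj; have nj := leq_trans nJ (leq_scale Jj).
  by rewrite /drift turn_clock !wave_clock_small ?subrr // ltnW.
- exact: drift_half_bounded.
rewrite /phase -big_split /=; apply: eq_bigr => j _.
by rewrite /drift turn_clock addrC subrK.
Qed.

Lemma mdist_start a b J n : (n <= scale J)%N ->
  orbit_dist skew_map (start a) (start b) n =
  Num.max (base_dist (clock a n) (clock b n)) (dist_int (phase a J n - phase b J n)).
Proof. by move=> nJ; rewrite /orbit_dist !(iter_start _ nJ) mdist_circle_of. Qed.

Lemma phase_notbad a j n : ~~ bad j n -> phase a j n = 0.
Proof.
move=> nb; rewrite /phase big_nat big1 // => i /andP[_ ij].
exact: wave_clock_notbad ij nb.
Qed.

Lemma orbit_dist_near a b j n : (n < scale j)%N -> ~~ bad j n ->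
  orbit_dist skew_map (start a) (start b) n <= 4^-1.
Proof.
move=> nj nb; rewrite (mdist_start a b (ltnW nj)) !phase_notbad // subrr.
rewrite ge_max base_dist_le4; have := @dist_int_le_norm R 0; rewrite normr0; lra.
Qed.

(** Truncating at [j.+1] keeps just the level [j] wave, which on its plateau is 1/2 or 0 according
    to the switch: the angles are antipodal. *)
Lemma orbit_dist_far a b j n : a j != b j ->
  (scale j + 2 ^ j <= n <= 2 * scale j - 2 ^ j)%N -> ~~ bad j n ->
  2^-1 <= orbit_dist skew_map (start a) (start b) n.
Proof.
move=> ab nj nb; have s2 := scaleS_ge j; have s8 := scale_ge j.
have p0 : (0 < 2 ^ j)%N by rewrite expn_gt0.
have nJ : (n <= scale j.+1)%N by lia.
rewrite (mdist_start a b nJ) le_max; apply/orP; right.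
have phaseE c : phase c j.+1 n = if c j then 2^-1 else 0.
  rewrite /phase big_nat_recr //= -/(phase c j n) phase_notbad // add0r /wave /=.
  case: (c j) => //; rewrite modn_small ?tent_plateau //; last by lia.
  by rewrite exprS -mulrA natrX -exprMn mulVf ?expr1n ?mulr1.
rewrite !phaseE; case: (a j) (b j) ab => [] [] // _.
  by rewrite subr0 dist_int_half.
by rewrite sub0r dist_intN dist_int_half.
Qed.

End SkewProduct.

(** * Oscillating visit frequencies *)

Section DC3.
Context {R : realType}.

Lemma card_ord_sum (P : nat -> bool) m :
  #|[pred k : 'I_m | P k]| = (\sum_(0 <= k < m) P k)%N.
Proof.
rewrite -sum1_card big_mkcond big_mkord; apply: eq_bigr => k _.
by rewrite inE; case: (P k).
Qed.

Variables (a b : nat -> bool).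

Lemma visit_frequency_ge (delta : R) j : 4^-1 < delta ->
  7 / 8 <= visit_frequency skew_map (start a) (start b) delta (scale j).
Proof.
move=> d4; rewrite /visit_frequency (@card_ord_sum
  (fun k => orbit_dist skew_map (start a) (start b) k < delta)).
rewrite ler_pdivlMl ?ltr0n ?scale_gt0 //.
rewrite mulrA ler_pdivrMr // -!natrM ler_nat mulnC [leqRHS]mulnC.
apply: visits_ge => k kj nb.
by apply: le_lt_trans d4; exact: orbit_dist_near kj nb.
Qed.

Lemma visit_frequency_le (delta : R) j : a j != b j -> delta < 2^-1 ->
  visit_frequency skew_map (start a) (start b) delta (2 * scale j) <= 3 / 4.
Proof.
move=> ab d2; rewrite /visit_frequency (@card_ord_sum
  (fun k => orbit_dist skew_map (start a) (start b) k < delta)).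
have sj : 0 < (scale j)%:R :> R by rewrite ltr0n scale_gt0.
rewrite ler_pdivrMl ?ltr0n ?muln_gt0 ?scale_gt0 //.
have : (8 * \sum_(0 <= k < (2 * scale j).+1)
    (orbit_dist skew_map (start a) (start b) k < delta)%R <= 12 * scale j)%N.
  apply: visits_le => k kj nb; rewrite -leNgt; apply: le_trans (ltW d2) _.
  exact: orbit_dist_far ab kj nb.
rewrite -(ler_nat R) !natrM; lra.
Qed.

(** For thresholds in (1/4, 1/2) the frequency is at least 7/8 at every time [scale j], but at most
    3/4 at time [2 * scale j] whenever the switches differ at [j]. *)
Lemma start_dc3 : (forall n, exists2 j, (n <= j)%N & a j != b j) ->
  dc3_pair skew_map (start a : skew_space R) (start b).
Proof.
move=> ab; exists 4^-1, 2^-1; split; [lra|lra| |].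
  (* Antipodal points of one fibre show that the diameter is at least 1/2. *)
  apply: ereal_sup_ubound; exists ((clock a 0, circle_of 2^-1), start a) => //=.
  rewrite mdist_circle_of base_distxx subr0 dist_int_half; congr EFin.
  by apply/max_idPr; rewrite invr_ge0.
move=> delta /andP[d4 d2]; apply: (@le_lt_trans _ _ (3 / 4)%:E).
  apply: limn_einf_le_frequently => n; have [j nj abj] := ab n.
  exists (2 * scale j)%N; first by have := ltn_scale j; lia.
  by rewrite lee_fin; exact: visit_frequency_le.
apply: (@lt_le_trans _ _ (7 / 8)%:E); first by rewrite lte_fin; lra.
apply: limn_esup_ge_frequently => n; exists (scale n).
  exact/ltnW/ltn_scale.
by rewrite lee_fin; exact: visit_frequency_ge.
Qed.

End DC3.

(** * An uncountable DC3 set and the conclusion *)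

Lemma start_inj {R : realType} : injective (@start R).
Proof.
move=> a b /(congr1 fst) /= ab; apply: funext => j.
by have := congr1 (fun x : base => (x j).1) ab.
Qed.

(* [logn 2 j.+1] takes every value infinitely often, so distinct sequences
   spread to sequences that differ infinitely often. *)
Definition spread (alpha : nat -> bool) (j : nat) : bool := alpha (logn 2 j.+1).

Lemma logn2_frequently v n : exists2 j, (n <= j)%N & logn 2 j.+1 = v.
Proof.
have p0 : (0 < 2 ^ v)%N by rewrite expn_gt0.
have jE : (2 ^ v * n.*2.+1).-1.+1 = (2 ^ v * n.*2.+1)%N.
  by rewrite prednK // muln_gt0 p0.
(* Here [j.+1] is [2 ^ v] times the odd number 2n + 1, which also forces [n <= j]. *)
exists (2 ^ v * n.*2.+1).-1.
  by rewrite -ltnS jE; nia.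
rewrite jE lognM // pfactorK // lognE /= dvdn2 /= odd_double.
by rewrite addn0.
Qed.

Lemma spread_frequently alpha beta n : alpha <> beta ->
  exists2 j, (n <= j)%N & spread alpha j != spread beta j.
Proof.
move=> ab; have [v abv] : exists v, alpha v != beta v.
  apply: contra_notP ab => /forallNP ab; apply: funext => v.
  by apply/eqP/negPn/negP/ab.
by have [j nj jv] := logn2_frequently v n; exists j; rewrite // /spread jv.
Qed.

Lemma uncountable_range_injective (T : Type) (g : (nat -> bool) -> T) :
  injective g -> ~ countable (range g).
Proof.
move=> gI /countable_injP[f fI].
(* Cantor's diagonal: [diag] negates, at each code n, the sequence coded by n. *)
pose diag n := ~~ `[< exists2 alpha, f (g alpha) = n & alpha n >].
have : diag (f (g diag)) = ~~ diag (f (g diag)).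
  rewrite {1}/diag; congr negb; apply/asboolP/idP => [[alpha fE alphaf]|dd].
    have eqd : alpha = diag.
      by apply/gI/fI => //; rewrite inE; [exists alpha|exists diag].
    by rewrite -{1}eqd.
  by exists diag.
by case: (diag _).
Qed.

Lemma skew_map_dc3 (R : realType) : dc3 (@skew_map R).
Proof.
have pointI : injective (@start R \o spread).
  move=> alpha beta /start_inj ab; apply: contrapT => /(spread_frequently 0)[j _].
  by rewrite ab eqxx.
exists (range (@start R \o spread)).
split; first exact: uncountable_range_injective.
move=> _ _ [alpha _ <-] [beta _ <-] ab; apply: start_dc3 => n.
by apply: spread_frequently => eqab; apply: ab; rewrite eqab.
Qed.

(** Scrambled pairs are proximal, so in a distal system a scrambled set has at most one point. *)
Lemma distal_not_li_yorke_chaotic (R : realType) (X : metricType R) (f : X -> X) :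
  distal f -> ~ li_yorke_chaotic f.
Proof.
move=> df [S [ncS scrS]]; apply: ncS.
have [->|/set0P[x Sx]] := eqVneq S set0; first exact: countable0.
apply: sub_countable (countable1 x); apply: subset_card_le => y Sy /=.
apply: contrapT => yx; have [_ prox _] := scrS _ _ Sy Sx yx.
exact: df yx prox.
Qed.

Lemma skew_map_dynamical_system (R : realType) :
  dynamical_system (@skew_map R).
Proof.
split; [by exists (start (fun=> false))|exact: space_compact|].
exact: skew_map_continuous.
Qed.

Theorem theorem1 (R : realType) :
  (exists (X : metricType R) (f : X -> X),
     dynamical_system f /\ distal f /\ dc3 f) /\
  (exists (X : metricType R) (f : X -> X),
     dynamical_system f /\ dc3 f /\ ~ li_yorke_chaotic f).
Proof.
have sys := skew_map_dynamical_system R.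
have dist := @skew_map_distal R; have chaos := skew_map_dc3 R.
split; exists (skew_space R), skew_map; split => //; split => //.
exact: distal_not_li_yorke_chaotic.
Qed.
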